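(* Let $M,\widetilde M\in\mathbb{C}^{n\times n}$ be normal matrices with eigenvalues $\lambda_j$, $\widetilde\lambda_j$ and corresponding orthonormal eigenvectors $\mathbf{u}_j$, $\widetilde{\mathbf{u}}_j$ ($j\in N=\{1,\dots,n\}$). Let $J,\widetilde J\subseteq N$ with $|J|=|\widetilde J|=q$, where $1\le q\le n-1$. Then: 1. If the denominator below is nonzero, $$d_{\mathrm{sp}}\left(\mathrm{span}(\mathbf{u}_J),\mathrm{span}(\widetilde{\mathbf{u}}_{\widetilde J})\right)\le\frac{\min\left(1,\sqrt{\frac{n-q}{q}}\right)}{\max\left(\mathrm{sep}(\lambda_J,\widetilde\lambda_{\widetilde J^c}),\ \mathrm{sep}(\lambda_{J^c},\widetilde\lambda_{\widetilde J})\right)}\,\|\widetilde M-M\|_2 .$$ 2. If the denominators below are nonzero, $$d_{\mathrm{sp}}\left(\mathrm{span}(\mathbf{u}_J),\mathrm{span}(\widetilde{\mathbf{u}}_{\widetilde J})\right)\le\frac{\frac{1}{\sqrt q}\|\widetilde M-M\|_F}{\sqrt{\mathrm{sep}(\lambda_J,\widetilde\lambda_{\widetilde J^c})^2+\mathrm{sep}(\lambda_{J^c},\widetilde\lambda_{\widetilde J})^2}}\le\sqrt{\frac{n/q}{\mathrm{sep}(\lambda_J,\widetilde\lambda_{\widetilde J^c})^2+\mathrm{sep}(\lambda_{J^c},\widetilde\lambda_{\widetilde J})^2}}\ \|\widetilde M-M\|_2 .$$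
   Context: For $S\subseteq N=\{1,\dots,n\}$: $\mathbf{u}_S=\{\mathbf{u}_j\mid j\in S\}$, $\widetilde{\mathbf{u}}_S=\{\widetilde{\mathbf{u}}_{j}\mid j\in S\}$, $\lambda_S=\{\lambda_j\mid j\in S\}$, $\widetilde\lambda_S=\{\widetilde\lambda_j\mid j\in S\}$ (multisets), and $S^c=N\setminus S$. Spans are complex linear spans in $\mathbb{C}^n$. Eigenvalues are listed with multiplicity, and $\{\mathbf{u}_j\}_{j\in N}$, $\{\widetilde{\mathbf{u}}_j\}_{j\in N}$ are orthonormal bases of $\mathbb{C}^n$ with $M\mathbf{u}_j=\lambda_j\mathbf{u}_j$, $\widetilde M\widetilde{\mathbf{u}}_j=\widetilde\lambda_j\widetilde{\mathbf{u}}_j$. For matrices, $\|\cdot\|_2$ is the operator norm induced by the Euclidean norm and $\|\cdot\|_F$ the Frobenius norm. $\mathrm{sep}(P,Q)=\min_{p\in P,\,q\in Q}|p-q|$. Subspace distance: for $q$-dimensional subspaces $X,Y\subseteq\mathbb{C}^n$, let $\mathbf{X},\mathbf{Y}\in\mathbb{C}^{n\times q}$ be matrices whose columns are orthonormal bases of $X$ and $Y$; then $d_{\mathrm{sp}}(X,Y)=\frac{1}{\sqrt{2q}}\|\mathbf{X}\mathbf{X}^\dagger-\mathbf{Y}\mathbf{Y}^\dagger\|_F$, where $^\dagger$ is the conjugate transpose (this does not depend on the chosen bases). *)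

(* Defs.v *)
From HB Require Import structures.
From mathcomp Require Import all_boot all_order all_algebra.
From mathcomp Require Import boolp classical_sets reals.
From mathcomp Require Import complex.

Set Implicit Arguments.
Unset Strict Implicit.
Unset Printing Implicit Defensive.

Import Order.TTheory GRing.Theory Num.Theory.
Local Open Scope ring_scope.
Local Open Scope sesquilinear_scope.
Local Open Scope complex_scope.

Lemma proj_eq (C : numClosedFieldType) n p q
    (A : 'M[C]_(n, p)) (B : 'M[C]_(n, q)) :
  A *m A^t* *m B = B -> B *m B^t* *m A = A -> A *m A^t* = B *m B^t*.
Proof.
have herm r (D : 'M[C]_(n, r)) : (D *m D^t*)^t* = D *m D^t*.
  rewrite trmx_mul map_mxM; congr (_ *m _).
  by apply/matrixP => i j; rewrite !mxE; apply: conjCK.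
move=> hB hA; have h : B *m B^t* *m (A *m A^t*) = A *m A^t* by rewrite mulmxA hA.
by rewrite -(herm _ A) -{1}h trmx_mul map_mxM !herm mulmxA hB.
Qed.

Section Definitions.
Variable R : realType.
Local Notation C := R[i].

(* The modulus as an element of R; `|z| itself is an element of R[i]. *)
Definition cmod (z : C) : R := ComplexField.Normc.normc z.

Definition frobnorm m n (A : 'M[C]_(m, n)) : R :=
  Num.sqrt (\sum_i \sum_j cmod (A i j) ^+ 2).

Definition l2norm n (x : 'cV[C]_n) : R :=
  Num.sqrt (\sum_i cmod (x i 0) ^+ 2).

(* The set is bounded, and nonempty when 0 < n, so this is a true supremum. *)
Definition opnorm m n (A : 'M[C]_(m, n)) : R :=
  sup [set l2norm (A *m x) | x in [set x : 'cV[C]_n | l2norm x = 1]]%classic.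

(* Finite multisets are sequences. Starting the iterated minimum at the head of
   the list makes it the minimum of the list; it is 0 when P or Q is empty. *)
Definition sep (P Q : seq C) : R :=
  let D := [seq cmod (p - q) | p <- P, q <- Q] in
  \big[Num.min/head 0 D]_(d <- D) d.

Definition orthonormal_basis n q (v : 'I_q -> 'cV[C]_n)
    (X : {vspace 'cV[C]_n}) : Prop :=
  (forall i j, ((v i)^t* *m v j) 0 0 = (i == j)%:R) /\
  <<[seq v j | j : 'I_q]>>%VS = X.

Lemma orthonormal_basis_exists n (X : {vspace 'cV[C]_n}) :
  exists A : 'M[C]_(n, \dim X), orthonormal_basis (fun j => col j A) X.
Proof.
have le_n : (\dim X <= n)%N.
  by have := dimvS (subvf X); rewrite dimvf /dim /= muln1.
pose B : 'M[C]_(\dim X, n) := \matrix_(i, j) (vbasis X)`_i j 0.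
pose S := schmidt B.
have Su : S \is unitarymx by apply: schmidt_unitarymx.
exists S^T; split.
  move=> i j; have /unitarymxP /matrixP /(_ j i) := Su.
  rewrite !mxE eq_sym => <-; apply: eq_bigr => k _.
  by rewrite !mxE mulrC.
apply/esym/eqP; rewrite eqEdim; apply/andP; split; last first.
  by rewrite (leq_trans (dim_span _)) // size_image card_ord.
rewrite -{1}(span_basis (vbasisP X)); apply/span_subvP => x.
case/(nthP 0) => k; rewrite size_tuple => ltk <-.
have /submxP [c Hc] : (row (Ordinal ltk) B <= S)%MS.
  by apply: submx_trans (row_sub _ _) (schmidt_sub _).
have -> : (vbasis X)`_k = \sum_j c 0 j *: col j S^T.
  apply/colP => i; have /rowP /(_ i) := Hc; rewrite !mxE /= => ->.
  by rewrite summxE; apply: eq_bigr => j _; rewrite !mxE.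
apply: memv_suml => j _; apply/memvZ/memv_span.
by apply/mapP; exists j; rewrite ?mem_enum.
Qed.

Definition onb n (X : {vspace 'cV[C]_n}) : 'M[C]_(n, \dim X) :=
  projT1 (cid (orthonormal_basis_exists X)).

(* Meant for \dim X = \dim Y, the common dimension being q. The choice of
   bases is immaterial: see dspE. *)
Definition dsp n (X Y : {vspace 'cV[C]_n}) : R :=
  frobnorm (onb X *m (onb X)^t* - onb Y *m (onb Y)^t*) /
  Num.sqrt (2 * (\dim X)%:R).

Lemma onb_fix n q q' (A : 'M[C]_(n, q)) (B : 'M[C]_(n, q')) X :
  orthonormal_basis (fun j => col j A) X ->
  orthonormal_basis (fun j => col j B) X -> A *m A^t* *m B = B.
Proof.
move=> [oA sA] [_ sB].
have AA : A^t* *m A = 1%:M.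
  apply/matrixP => i j; rewrite [RHS]mxE -oA !mxE.
  by apply: eq_bigr => k _; rewrite !mxE.
suff H x : x \in X -> A *m A^t* *m x = x.
  apply/matrixP => i j.
  have /H /colP /(_ i) : col j B \in X.
    by rewrite -sB; by apply/memv_span/mapP; exists j; rewrite ?mem_enum.
  by rewrite !mxE => <-; apply: eq_bigr => k _; rewrite !mxE.
rewrite -sA => /coord_span ->; rewrite mulmx_sumr; apply: eq_bigr => k _.
rewrite -scalemxAr; congr (_ *: _).
have ltk : (k < size [seq col j A | j : 'I_q])%N.
  by rewrite size_image; apply: ltn_ord.
have /mapP [j _ ->] := mem_nth 0 ltk.
by rewrite colE mulmxA -[A *m _ *m A]mulmxA AA mulmx1.
Qed.

Lemma dspE n q q' (X Y : {vspace 'cV[C]_n})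
    (A : 'M[C]_(n, q)) (B : 'M[C]_(n, q')) :
  orthonormal_basis (fun j => col j A) X ->
  orthonormal_basis (fun j => col j B) Y ->
  dsp X Y =
  frobnorm (A *m A^t* - B *m B^t*) / Num.sqrt (2 * (\dim X)%:R).
Proof.
have E p p' Z (D : 'M[C]_(n, p)) (D' : 'M[C]_(n, p')) :
    orthonormal_basis (fun j => col j D) Z ->
    orthonormal_basis (fun j => col j D') Z -> D *m D^t* = D' *m D'^t*.
  by move=> hD hD'; apply: proj_eq; [apply: onb_fix hD hD' | apply: onb_fix hD' hD].
rewrite /dsp /onb.
case: cid => A' hA'; case: cid => B' hB' /= hA hB.
by rewrite (E _ _ _ _ _ hA hA') (E _ _ _ _ _ hB hB').
Qed.

End Definitions.

(* Main.v *)
(** Write U and V for the unitary matrices of the two eigenbases, W = U^* V and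
    G = U^* (Mt - M) V. Then G_jk = (lamt_k - lam_j) W_jk, and, with q = |J|,
    dsp^2 = S / q where S is the sum of |W_jk|^2 over J x Jt^c, which equals the
    sum over J^c x Jt because |W_jk|^2 is doubly stochastic. Hence s1^2 S and
    s2^2 S are at most the sums of |G_jk|^2 over these two disjoint blocks.
    Together the blocks contribute at most the squared Frobenius norm of Mt - M,
    and each row and each column of G has norm at most its operator norm; a
    block has q rows and n - q columns or conversely. *)
Require Import Defs.
From HB Require Import structures.
From mathcomp Require Import all_boot all_order all_algebra.
From mathcomp Require Import boolp classical_sets reals.
From mathcomp Require Import complex ring.
Set Implicit Arguments.
Unset Strict Implicit.
Unset Printing Implicit Defensive.
Import Order.TTheory GRing.Theory Num.Theory.
Local Open Scope ring_scope.
Local Open Scope sesquilinear_scope.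
Local Open Scope complex_scope.

(** * Moduli, Frobenius norms and their invariance under unitary factors *)

Section Norms.
Variable R : realType.
Local Notation C := R[i].
Implicit Types (m n p : nat).

Definition frobsq m n (A : 'M[C]_(m, n)) : R :=
  \sum_i \sum_j cmod (A i j) ^+ 2.

Lemma cmodE (z : C) : (cmod z)%:C = `|z|.
Proof. by rewrite normc_def; case: z. Qed.

Lemma cmod_sqE (z : C) : (cmod z ^+ 2)%:C = z * z^*.
Proof. by rewrite rmorphXn /= cmodE normCK. Qed.

Lemma cmod_ge0 (z : C) : 0 <= cmod z.
Proof. by rewrite -lecR cmodE normr_ge0. Qed.

Lemma cmodM (y z : C) : cmod (y * z) = cmod y * cmod z.
Proof. exact: ComplexField.Normc.normcM. Qed.

Lemma cmodC (z : C) : cmod (z^*) = cmod z.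
Proof. by apply: (fmorph_inj (real_complex R)); rewrite /= !cmodE norm_conjC. Qed.

Lemma cmodN (z : C) : cmod (- z) = cmod z.
Proof. by apply: (fmorph_inj (real_complex R)); rewrite /= !cmodE normrN. Qed.

Lemma cmod0 : cmod (0 : C) = 0.
Proof. exact: ComplexField.Normc.normc0. Qed.

Lemma frobsq_ge0 m n (A : 'M[C]_(m, n)) : 0 <= frobsq A.
Proof. by apply: sumr_ge0 => i _; apply: sumr_ge0 => j _; apply: sqr_ge0. Qed.

Lemma frobnorm_sq m n (A : 'M[C]_(m, n)) : frobnorm A ^+ 2 = frobsq A.
Proof. exact: sqr_sqrtr (frobsq_ge0 A). Qed.

(** In trace form, a factor [V] with [V *m V^t* = 1%:M] cancels inside the product, which gives the
    unitary invariance below. *)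
Lemma frobsqE m n (A : 'M[C]_(m, n)) : (frobsq A)%:C = \tr (A *m A^t*).
Proof.
rewrite rmorph_sum; apply: eq_bigr => i _; rewrite mxE rmorph_sum.
by apply: eq_bigr => j _; rewrite !mxE; apply: cmod_sqE.
Qed.

Lemma trmxCK m n (A : 'M[C]_(m, n)) : (A^t*)^t* = A.
Proof. by apply/matrixP => i j; rewrite !mxE conjCK. Qed.

Lemma trmxC_mul m n p (A : 'M[C]_(m, n)) (B : 'M[C]_(n, p)) :
  (A *m B)^t* = B^t* *m A^t*.
Proof. by rewrite trmx_mul map_mxM. Qed.

Lemma frobsq_trC m n (A : 'M[C]_(m, n)) : frobsq (A^t*) = frobsq A.
Proof.
rewrite /frobsq exchange_big; apply: eq_bigr => i _; apply: eq_bigr => j _.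
by rewrite !mxE cmodC.
Qed.

Lemma frobsq_mulr m n p (A : 'M[C]_(m, n)) (V : 'M[C]_(n, p)) :
  V *m V^t* = 1%:M -> frobsq (A *m V) = frobsq A.
Proof.
move=> VV; apply: (fmorph_inj (real_complex R)); rewrite /= !frobsqE.
by rewrite trmxC_mul mulmxA -[A *m V *m _]mulmxA VV mulmx1.
Qed.

Lemma frobsq_mull m n p (A : 'M[C]_(m, n)) (U : 'M[C]_(p, m)) :
  U^t* *m U = 1%:M -> frobsq (U *m A) = frobsq A.
Proof.
move=> UU; rewrite -frobsq_trC trmxC_mul frobsq_mulr ?trmxCK //.
exact: frobsq_trC.
Qed.

Lemma frobsq_row m n (A : 'M[C]_(m, n)) :
  frobsq A = \sum_i frobsq (row i A).
Proof.
apply: eq_bigr => i _; rewrite /frobsq big_ord1.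
by apply: eq_bigr => j _; rewrite mxE.
Qed.

Lemma frobsq_col m n (A : 'M[C]_(m, n)) :
  frobsq A = \sum_j frobsq (col j A).
Proof.
rewrite /frobsq exchange_big; apply: eq_bigr => j _; apply: eq_bigr => i _.
by rewrite big_ord1 mxE.
Qed.

(** * Euclidean norm and operator norm *)

Lemma l2norm_sq n (x : 'cV[C]_n) : l2norm x ^+ 2 = frobsq x.
Proof.
have E : frobsq x = \sum_i cmod (x i 0) ^+ 2.
  by apply: eq_bigr => i _; rewrite big_ord1.
by rewrite E sqr_sqrtr // -E frobsq_ge0.
Qed.

Lemma l2norm_eq1 n (x : 'cV[C]_n) : frobsq x = 1 -> l2norm x = 1.
Proof.
by rewrite -l2norm_sq => /eqP; rewrite sqrp_eq1 ?sqrtr_ge0 // => /eqP.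
Qed.

(* Crude entrywise bound, only needed for the supremum to be finite. *)
Lemma frobsq_mul_bound m n (A : 'M[C]_(m, n)) (x : 'cV[C]_n) :
  frobsq x = 1 ->
  frobsq (A *m x) <= \sum_i (\sum_j cmod (A i j)) ^+ 2.
Proof.
move=> x1; apply: ler_sum => i _; rewrite big_ord1 ler_sqr ?nnegrE ?cmod_ge0 //;
  last by apply: sumr_ge0 => j _; apply: cmod_ge0.
have xj j : cmod (x j 0) <= 1.
  rewrite -(@ler_pXn2r _ 2) ?nnegrE ?cmod_ge0 // expr1n -x1.
  rewrite /frobsq (bigD1 j) //= big_ord1 lerDl.
  by apply: sumr_ge0 => k _; apply: sumr_ge0 => l _; apply: sqr_ge0.
rewrite -lecR cmodE mxE (le_trans (ler_norm_sum _ _ _)) // rmorph_sum /=.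
apply: ler_sum => j _; rewrite -cmodE lecR cmodM.
by rewrite ler_piMr ?cmod_ge0.
Qed.

Lemma l2norm_le_opnorm m n (A : 'M[C]_(m, n)) (x : 'cV[C]_n) :
  frobsq x = 1 -> l2norm (A *m x) <= opnorm A.
Proof.
move=> x1; apply: ub_le_sup; last by exists x => //=; apply: l2norm_eq1.
exists (Num.sqrt (\sum_i (\sum_j cmod (A i j)) ^+ 2)) => _ [y /= y1 <-].
have fy : frobsq y = 1 by rewrite -l2norm_sq y1 expr1n.
rewrite -(@ler_pXn2r _ 2) ?nnegrE ?sqrtr_ge0 // l2norm_sq sqr_sqrtr.
  exact: frobsq_mul_bound.
by apply: sumr_ge0 => i _; apply: sqr_ge0.
Qed.

Lemma frobsq_mul_le_opnorm m n (A : 'M[C]_(m, n)) (x : 'cV[C]_n) :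
  frobsq x = 1 -> frobsq (A *m x) <= opnorm A ^+ 2.
Proof.
move=> x1; have le := l2norm_le_opnorm A x1.
have ge : 0 <= l2norm (A *m x) := sqrtr_ge0 _.
by rewrite -l2norm_sq ler_sqr ?nnegrE // (le_trans ge).
Qed.

Lemma frobsqZ m n (a : C) (A : 'M[C]_(m, n)) :
  frobsq (a *: A) = cmod a ^+ 2 * frobsq A.
Proof.
rewrite /frobsq mulr_sumr; apply: eq_bigr => i _; rewrite mulr_sumr.
by apply: eq_bigr => j _; rewrite mxE cmodM exprMn.
Qed.

Lemma cmod_real (a : R) : 0 <= a -> cmod a%:C = a.
Proof.
by move=> a0; rewrite /cmod /= expr0n /= addr0 sqrtr_sqr ger0_norm.
Qed.

Lemma frobsq_gram n (y : 'cV[C]_n) : frobsq (y^t* *m y) = frobsq y ^+ 2.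
Proof.
have E : (y^t* *m y) 0 0 = (frobsq y)%:C.
  by rewrite frobsqE mxtrace_mulC /mxtrace big_ord1.
by rewrite {1}/frobsq !big_ord1 E cmod_real ?frobsq_ge0.
Qed.

(** Column [k] of [A *m V] is [A] applied to column [k] of [V], a unit vector because its squared
    norm is a diagonal entry of [V^t* *m V]. *)
Lemma frobsq_col_le_opnorm m n p k (A : 'M[C]_(m, n)) (V : 'M[C]_(n, p)) :
  V^t* *m V = 1%:M -> frobsq (col k (A *m V)) <= opnorm A ^+ 2.
Proof.
move=> VV; rewrite !colE -mulmxA -colE; apply: frobsq_mul_le_opnorm.
apply: (fmorph_inj (real_complex R)); rewrite /= frobsqE mxtrace_mulC.
have -> : (1 : R)%:C = (1%:M : 'M[C]_p) k k by rewrite mxE eqxx.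
rewrite /mxtrace big_ord1 -VV !mxE.
by apply: eq_bigr => i _; rewrite !mxE.
Qed.

(* With y the adjoint of the i-th row of U A, the i-th entry of U A (y / |y|)
   is |y|, while U does not increase norms; this avoids the adjoint of A. *)
Lemma frobsq_row_le_opnorm m n p i (A : 'M[C]_(m, n)) (U : 'M[C]_(p, m)) :
  U^t* *m U = 1%:M -> frobsq (row i (U *m A)) <= opnorm A ^+ 2.
Proof.
move=> UU; set y := (row i (U *m A))^t*.
have -> : frobsq (row i (U *m A)) = frobsq y by rewrite frobsq_trC.
(* A zero row is treated apart, since [c] below inverts the norm of [y]. *)
have := frobsq_ge0 y; rewrite le_eqVlt => /predU1P[<-|y0]; first exact: sqr_ge0.
pose c := (Num.sqrt (frobsq y))^-1.
have c2 : cmod c%:C ^+ 2 = (frobsq y)^-1.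
  by rewrite cmod_real ?invr_ge0 ?sqrtr_ge0 // exprVn sqr_sqrtr ?ltW.
have x1 : frobsq (c%:C *: y) = 1 by rewrite frobsqZ c2 mulVf ?gt_eqF.
apply: le_trans (frobsq_mul_le_opnorm A x1).
have -> : frobsq y = frobsq (row i (U *m (A *m (c%:C *: y)))).
  rewrite mulmxA row_mul -[row i _]trmxCK -/y -scalemxAr frobsqZ c2 frobsq_gram.
  by rewrite expr2 mulKf ?gt_eqF.
rewrite -[leRHS](frobsq_mull _ UU) [leRHS]frobsq_row (bigD1 i) //= lerDl.
by apply: sumr_ge0 => j _; apply: frobsq_ge0.
Qed.

(** Multiplying by [U^t*] on the left and by [V] on the right keeps the Frobenius norm and cancels
    the outer factors. *)
Lemma frobsq_sub_conj n (U V D D' : 'M[C]_n) :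
  U^t* *m U = 1%:M -> V^t* *m V = 1%:M ->
  frobsq (U *m D *m U^t* - V *m D' *m V^t*) =
  frobsq (D *m (U^t* *m V) - U^t* *m V *m D').
Proof.
move=> UU VV; rewrite -(frobsq_mulr _ (mulmx1C VV)).
have UU' : (U^t*)^t* *m U^t* = 1%:M by rewrite trmxCK mulmx1C.
rewrite -(frobsq_mull _ UU'); apply: congr1.
rewrite mulmxBl mulmxBr !mulmxA UU mul1mx.
by rewrite -[_ *m V^t* *m V]mulmxA VV mulmx1.
Qed.

Lemma opnorm_ge0 m n (A : 'M[C]_(m, n)) : 0 <= opnorm A.
Proof.
rewrite /opnorm; set S := image _ _.
(* Without unit vectors ([n = 0]) the set is empty and its supremum is 0 by convention. *)
have [->|/set0P[_ [x /= x1 _]]] := eqVneq S set0; first by rewrite sup0.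
have fx : frobsq x = 1 by rewrite -l2norm_sq x1 expr1n.
by apply: le_trans (l2norm_le_opnorm A fx); apply: sqrtr_ge0.
Qed.

(** * Separation of multisets *)

Lemma sep_ge0 (P Q : seq C) : 0 <= sep P Q.
Proof.
have D0 d : d \in [seq cmod (a - b) | a <- P, b <- Q] -> 0 <= d.
  by case/allpairsP => -[a b] [_ _ ->]; apply: cmod_ge0.
rewrite /sep; set D := [seq _ | _ <- _, _ <- _] in D0 *.
rewrite big_seq; apply: le_bigmin => //.
(* The minimum starts at the head of the list: 0 if the list is empty, otherwise one of the
   moduli. *)
by case: D D0 => //= d D -> //; rewrite mem_head.
Qed.

Lemma sep_le (P Q : seq C) a b : a \in P -> b \in Q -> sep P Q <= cmod (a - b).
Proof.
by move=> aP bQ; apply: ge_bigmin_seq => //; apply: allpairs_f.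
Qed.

(** * Sums of squared moduli over blocks *)

Definition blocksq m n (A : 'M[C]_(m, n)) (I : {set 'I_m}) (K : {set 'I_n}) : R :=
  \sum_(i in I) \sum_(k in K) cmod (A i k) ^+ 2.

Lemma blocksq_ge0 m n (A : 'M[C]_(m, n)) I K : 0 <= blocksq A I K.
Proof. by apply: sumr_ge0 => i _; apply: sumr_ge0 => k _; apply: sqr_ge0. Qed.

Lemma blocksq_le_row m n (A : 'M[C]_(m, n)) I K a :
  (forall i, frobsq (row i A) <= a) -> blocksq A I K <= #|I|%:R * a.
Proof.
move=> rowa; rewrite mulr_natl -sumr_const; apply: ler_sum => i _.
apply: le_trans (rowa i); rewrite /frobsq big_ord1.
under [leRHS]eq_bigr do rewrite mxE.
by rewrite [leRHS](bigID (mem K)) /= lerDl; apply: sumr_ge0 => k _; apply: sqr_ge0.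
Qed.

Lemma blocksq_tr m n (A : 'M[C]_(m, n)) I K : blocksq A^T K I = blocksq A I K.
Proof.
rewrite /blocksq exchange_big; apply: eq_bigr => i _; apply: eq_bigr => k _.
by rewrite mxE.
Qed.

Lemma blocksq_le_col m n (A : 'M[C]_(m, n)) I K a :
  (forall k, frobsq (col k A) <= a) -> blocksq A I K <= #|K|%:R * a.
Proof.
move=> cola; rewrite -blocksq_tr; apply: blocksq_le_row => k.
apply: le_trans (cola k); rewrite -tr_col.
by rewrite /frobsq exchange_big; under eq_bigr do under eq_bigr do rewrite mxE.
Qed.

Lemma frobsq_blocks m n (A : 'M[C]_(m, n)) I K :
  frobsq A = (blocksq A I K + blocksq A I (~: K)) +
             (blocksq A (~: I) K + blocksq A (~: I) (~: K)).
Proof.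
rewrite /frobsq (bigID (mem I)) /= /blocksq -!big_split /=; congr (_ + _).
  apply: eq_bigr => i _; rewrite (bigID (mem K)) /=; congr (_ + _).
  by apply: eq_bigl => k; rewrite finset.in_setC.
apply: eq_big => [i|i _]; first by rewrite finset.in_setC.
rewrite (bigID (mem K)) /=; congr (_ + _).
by apply: eq_bigl => k; rewrite finset.in_setC.
Qed.

(** Each row of [W] has squared norm 1, a diagonal entry of [W *m W^t*]. *)
Lemma blocksq_unitary_row n (W : 'M[C]_n) (I K : {set 'I_n}) :
  W *m W^t* = 1%:M -> blocksq W I K + blocksq W I (~: K) = #|I|%:R.
Proof.
move=> WW; rewrite /blocksq -big_split /= -[RHS]sumr_const.
apply: eq_bigr => i _; apply: (fmorph_inj (real_complex R)).
transitivity ((1%:M : 'M[C]_n) i i); last by rewrite mxE eqxx.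
rewrite -WW !mxE [RHS](bigID (mem K)) rmorphD !rmorph_sum; congr (_ + _).
  by apply: eq_bigr => k _; rewrite !mxE; apply: cmod_sqE.
apply: eq_big => [k|k _]; first by rewrite finset.in_setC.
by rewrite !mxE; apply: cmod_sqE.
Qed.

(** The rows in [I] weigh [#|I|] in total and the columns in [K] weigh [#|K|]; removing the common
    block from these equal totals leaves the two sides. *)
Lemma blocksq_unitary_sym n (W : 'M[C]_n) (I K : {set 'I_n}) :
  W *m W^t* = 1%:M -> #|I| = #|K| -> blocksq W (~: I) K = blocksq W I (~: K).
Proof.
move=> WW IK; apply: (@addrI _ (blocksq W I K)).
rewrite blocksq_unitary_row // IK -[blocksq W I K]blocksq_tr.
rewrite -[blocksq W (~: I) K]blocksq_tr blocksq_unitary_row //.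
(* The transpose of a unitary matrix is unitary, so column sums are row sums of [W^T]. *)
by have /(congr1 trmx) := mulmx1C WW; rewrite trmx_mul map_trmx trmx1.
Qed.

End Norms.

(** * Spans of basis vectors and their orthogonal projections *)

Section Subspaces.
Variables (R : realType) (n : nat).
Local Notation C := R[i].
Implicit Types (u : 'I_n -> 'cV[C]_n) (J Jt : {set 'I_n}).

Definition basis_mx u : 'M[C]_n := \matrix_(i, j) u j i 0.

Definition coord_proj J : 'M[C]_n := diag_mx (\row_j (j \in J)%:R).

Lemma basis_mx_unitary u : orthonormal_basis u fullv ->
  (basis_mx u)^t* *m basis_mx u = 1%:M.
Proof.
move=> [uu _]; apply/matrixP => i j; rewrite [RHS]mxE -uu !mxE.
by apply: eq_bigr => k _; rewrite !mxE.
Qed.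

(** Spanning a space of dimension n with n vectors makes them free, and a subfamily of a free family
    is free. *)
Lemma dim_span_basis u J : <<[seq u j | j : 'I_n]>>%VS = fullv ->
  \dim <<[seq u j | j in J]>> = #|J|.
Proof.
move=> su.
have fr : free [seq u j | j : 'I_n].
  apply: (@basis_free _ _ fullv); rewrite basisEdim su subvf /=.
  by rewrite size_image card_ord dimvf /dim /= muln1.
suff /eqP -> : free [seq u j | j in J] by rewrite size_image.
have pe : perm_eq [seq u j | j : 'I_n]
    ([seq u j | j in J] ++ [seq u j | j in ~: J]).
  rewrite -map_cat; apply: perm_map; apply: uniq_perm; rewrite ?enum_uniq //.
    rewrite cat_uniq !enum_uniq andbT /=; apply/hasPn => x.
    by rewrite !mem_enum inE.
  by move=> x; rewrite mem_cat !mem_enum finset.in_setC orbN.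
by move: fr; rewrite (perm_free pe) => /catl_free.
Qed.

Lemma orthonormal_span u J : orthonormal_basis u fullv ->
  orthonormal_basis (fun k : 'I_#|J| => col k (colsub enum_val (basis_mx u)))
    <<[seq u j | j in J]>>%VS.
Proof.
have ck k : col k (colsub enum_val (basis_mx u)) = u (@enum_val _ (mem J) k).
  by apply/colP => i; rewrite !mxE.
move=> [uu _]; split=> [i j|].
  by rewrite !ck uu (inj_eq enum_val_inj).
apply/eqP; rewrite eqEsubv; apply/andP; split; apply/span_subvP => x.
  case/mapP => k _ ->; rewrite ck; apply/memv_span/mapP.
  by exists (enum_val k) => //; rewrite mem_enum enum_valP.
case/mapP => j; rewrite mem_enum => jJ ->; apply/memv_span/mapP.
by exists (enum_rank_in jJ j); rewrite ?mem_enum // ck enum_rankK_in.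
Qed.

(** The projection onto the span becomes a coordinate projection conjugated by the full basis
    matrix, the form that [frobsq_sub_conj] takes. *)
Lemma span_projE u J :
  let A := colsub (@enum_val _ (mem J)) (basis_mx u) in
  A *m A^t* = basis_mx u *m coord_proj J *m (basis_mx u)^t*.
Proof.
apply/matrixP => a b; rewrite mul_mx_diag !mxE.
rewrite [RHS](bigID (mem J)) /= [X in _ + X]big1 ?addr0.
  by rewrite [RHS]big_enum_val; apply: eq_bigr => k _; rewrite !mxE enum_valP mulr1.
by move=> j /negbTE jJ; rewrite !mxE jJ mulr0 mul0r.
Qed.

Lemma dsp_sq u v J Jt : orthonormal_basis u fullv -> orthonormal_basis v fullv ->
  dsp <<[seq u j | j in J]>>%VS <<[seq v j | j in Jt]>>%VS ^+ 2 =
  frobsq (coord_proj J *m ((basis_mx u)^t* *m basis_mx v) -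
          (basis_mx u)^t* *m basis_mx v *m coord_proj Jt) / (2 * #|J|%:R).
Proof.
move=> hu hv; rewrite (dspE (orthonormal_span J hu) (orthonormal_span Jt hv)).
rewrite !span_projE dim_span_basis; last by case: hu.
rewrite expr_div_n frobnorm_sq sqr_sqrtr; last by rewrite mulr_ge0 ?ler0n.
exact: (congr1 (fun x : R => x / (2 * #|J|%:R))
  (frobsq_sub_conj _ _ (basis_mx_unitary hu) (basis_mx_unitary hv))).
Qed.

End Subspaces.

(** Entry (j, k) of the difference is ([j in J] - [k in Jt]) W_jk: it vanishes on the two diagonal
    blocks and is W_jk up to sign on the other two. *)
Lemma frobsq_coord_proj (R : realType) n (W : 'M[R[i]]_n) (J Jt : {set 'I_n}) :
  frobsq (coord_proj R J *m W - W *m coord_proj R Jt) =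
  blocksq W J (~: Jt) + blocksq W (~: J) Jt.
Proof.
rewrite mul_diag_mx mul_mx_diag (frobsq_blocks _ J Jt).
have E (b c : bool) (K L : {set 'I_n}) :
    (forall j, j \in K -> (j \in J) = b) -> (forall k, k \in L -> (k \in Jt) = c) ->
    blocksq (\matrix_(i, j) ((\row_j (j \in J)%:R) 0 i * W i j) -
      \matrix_(i, j) (W i j * (\row_j (j \in Jt)%:R) 0 j)) K L =
    (b != c)%:R * blocksq W K L.
  move=> hb hc; rewrite mulr_sumr; apply: eq_bigr => j /hb jb.
  rewrite mulr_sumr; apply: eq_bigr => k /hc kc; rewrite !mxE jb kc.
  case: b c {jb kc hb hc} => -[];
    rewrite /= !(mul1r, mulr1, mul0r, mulr0, subrr, subr0, sub0r).
  - by rewrite ?oppr0 (cmod0 R) expr0n.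
  - by [].
  - by rewrite cmodN.
  - by rewrite ?oppr0 (cmod0 R) expr0n.
have inC (K : {set 'I_n}) j : j \in ~: K -> (j \in K) = false.
  by rewrite finset.in_setC => /negbTE.
rewrite (E true true) // (E true false) //; last by exact: inC.
rewrite (E false true) //; last by exact: inC.
rewrite (E false false) //; [|exact: inC|exact: inC].
by rewrite /= !mul0r !mul1r add0r addr0.
Qed.

(** * The perturbation expressed in the two eigenbases *)

Section Perturbation.
Variables (R : realType) (n : nat).
Local Notation C := R[i].
Variables (M Mt : 'M[C]_n) (lam lamt : 'I_n -> C) (u ut : 'I_n -> 'cV[C]_n).
Hypothesis hu : orthonormal_basis u fullv.
Hypothesis hut : orthonormal_basis ut fullv.
Hypothesis hlam : forall j, M *m u j = lam j *: u j.
Hypothesis hlamt : forall j, Mt *m ut j = lamt j *: ut j.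

Let U := basis_mx u.
Let V := basis_mx ut.
Let W := U^t* *m V.
Let G := U^t* *m (Mt - M) *m V.

Let UU : U^t* *m U = 1%:M. Proof. exact: basis_mx_unitary. Qed.
Let VV : V^t* *m V = 1%:M. Proof. exact: basis_mx_unitary. Qed.
Let UU' : (U^t*)^t* *m U^t* = 1%:M. Proof. by rewrite trmxCK mulmx1C. Qed.

Lemma overlap_unitary : W *m W^t* = 1%:M.
Proof.
by rewrite trmxC_mul trmxCK mulmxA -[U^t* *m V *m _]mulmxA (mulmx1C VV) mulmx1.
Qed.

Lemma eigen_basis_mx (A : 'M[C]_n) (mu : 'I_n -> C) v :
  (forall j, A *m v j = mu j *: v j) ->
  A *m basis_mx v = basis_mx v *m diag_mx (\row_j mu j).
Proof.
move=> Av; apply/matrixP => i j; rewrite mul_mx_diag !mxE.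
have /colP /(_ i) := Av j; rewrite !mxE mulrC => <-.
by apply: eq_bigr => k _; rewrite !mxE.
Qed.

(** The eigenvalues of [Mt] scale the columns of [W], those of [M] its rows. *)
Lemma perturbation_entry j k : G j k = (lamt k - lam j) * W j k.
Proof.
have EV : U^t* *m Mt *m V = W *m diag_mx (\row_j lamt j).
  by rewrite -mulmxA (eigen_basis_mx hlamt) mulmxA.
(* Unitarity of [U] turns the right eigenvector relation for [M] into a left one. *)
have EU : U^t* *m M = diag_mx (\row_j lam j) *m U^t*.
  rewrite -[LHS]mulmx1 -(mulmx1C UU) mulmxA -[U^t* *m M *m U]mulmxA.
  by rewrite (eigen_basis_mx hlam) mulmxA UU mul1mx.
rewrite /G mulmxBr mulmxBl EV EU -[diag_mx _ *m _ *m V]mulmxA -/W.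
generalize W => W'.
by rewrite mul_mx_diag mul_diag_mx !mxE mulrBl [W' j k * _]mulrC.
Qed.

Lemma sep_blocksq (I K : {set 'I_n}) :
  sep [seq lam j | j in I] [seq lamt k | k in K] ^+ 2 * blocksq W I K <=
  blocksq G I K.
Proof.
rewrite mulr_sumr; apply: ler_sum => j jI; rewrite mulr_sumr.
apply: ler_sum => k kK; rewrite perturbation_entry cmodM exprMn.
apply: ler_wpM2r; first exact: sqr_ge0.
rewrite ler_sqr ?nnegrE ?sep_ge0 ?cmod_ge0 //.
rewrite -cmodN opprB.
by apply: sep_le; apply: map_f; rewrite mem_enum.
Qed.

Lemma frobsq_perturbation : frobsq G = frobsq (Mt - M).
Proof. by rewrite /G (frobsq_mulr _ (mulmx1C VV)) (frobsq_mull _ UU'). Qed.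

(** The factor [V] does not change row norms, so each row of [G] is as long as a row of
    [U^t* *m (Mt - M)]. *)
Lemma blocksq_le_opnorm_row (I K : {set 'I_n}) :
  blocksq G I K <= #|I|%:R * opnorm (Mt - M) ^+ 2.
Proof.
apply: blocksq_le_row => i.
have -> : frobsq (row i G) = frobsq (row i (U^t* *m (Mt - M))).
  by rewrite /G row_mul (frobsq_mulr _ (mulmx1C VV)).
exact: frobsq_row_le_opnorm.
Qed.

Lemma blocksq_le_opnorm_col (I K : {set 'I_n}) :
  blocksq G I K <= #|K|%:R * opnorm (Mt - M) ^+ 2.
Proof.
apply: blocksq_le_col => k.
have -> : frobsq (col k G) = frobsq (col k ((Mt - M) *m V)).
  by rewrite /G -mulmxA !colE -mulmxA (frobsq_mull _ UU').
exact: frobsq_col_le_opnorm.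
Qed.

(** The squared Frobenius norm is the sum over the n columns of [(Mt - M) *m V], each an image of a
    unit vector. *)
Lemma frobsq_le_opnorm : frobsq (Mt - M) <= n%:R * opnorm (Mt - M) ^+ 2.
Proof.
rewrite -(frobsq_mulr _ (mulmx1C VV)) frobsq_col.
rewrite -[n in n%:R]card_ord mulr_natl -sumr_const.
by apply: ler_sum => k _; apply: frobsq_col_le_opnorm.
Qed.

(** The two off-diagonal blocks weigh the same, so their sum cancels the 2 in the normalisation of
    [dsp]. *)
Lemma dsp_spanE (J Jt : {set 'I_n}) : #|J| = #|Jt| ->
  dsp <<[seq u j | j in J]>>%VS <<[seq ut j | j in Jt]>>%VS ^+ 2 =
  blocksq W J (~: Jt) / #|J|%:R.
Proof.
move=> JJt; rewrite dsp_sq // frobsq_coord_proj -/U -/V -/W.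
rewrite (blocksq_unitary_sym overlap_unitary JJt) -mulr2n.
rewrite -[blocksq _ _ _ *+ 2]mulr_natl.
by rewrite -mulf_div divff ?mul1r // pnatr_eq0.
Qed.

End Perturbation.

(** * The bounds of the theorem, obtained by comparing squares *)

Lemma le_of_sqr_le (R : rcfType) (d b : R) :
  0 <= b -> d ^+ 2 <= b ^+ 2 -> d <= b.
Proof.
move=> b0 db; rewrite (le_trans (ler_norm d)) // -sqrtr_sqr -(ger0_norm b0).
by rewrite -[leRHS]sqrtr_sqr ler_wsqrtr.
Qed.
Theorem corollary5 (R : realType) (n q : nat)
    (M Mt : 'M[R[i]]_n) (lam lamt : 'I_n -> R[i])
    (u ut : 'I_n -> 'cV[R[i]]_n) (J Jt : {set 'I_n})
    (hM : M \is normalmx) (hMt : Mt \is normalmx)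
    (hu : orthonormal_basis u fullv) (hut : orthonormal_basis ut fullv)
    (hlam : forall j, M *m u j = lam j *: u j)
    (hlamt : forall j, Mt *m ut j = lamt j *: ut j)
    (hq : (1 <= q <= n - 1)%N) (hJ : #|J| = q) (hJt : #|Jt| = q) :
  let X := <<[seq u j | j in J]>>%VS in
  let Y := <<[seq ut j | j in Jt]>>%VS in
  let s1 := sep [seq lam j | j in J] [seq lamt j | j in ~: Jt] in
  let s2 := sep [seq lam j | j in ~: J] [seq lamt j | j in Jt] in
  (Num.max s1 s2 != 0 ->
     dsp X Y <=
       Num.min 1 (Num.sqrt ((n%:R - q%:R) / q%:R)) / Num.max s1 s2
       * opnorm (Mt - M)) /\
  (Num.sqrt (s1 ^+ 2 + s2 ^+ 2) != 0 -> s1 ^+ 2 + s2 ^+ 2 != 0 ->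
     dsp X Y <=
       (Num.sqrt q%:R)^-1 * frobnorm (Mt - M)
       / Num.sqrt (s1 ^+ 2 + s2 ^+ 2) /\
     (Num.sqrt q%:R)^-1 * frobnorm (Mt - M)
       / Num.sqrt (s1 ^+ 2 + s2 ^+ 2) <=
       Num.sqrt (n%:R / q%:R / (s1 ^+ 2 + s2 ^+ 2)) * opnorm (Mt - M)).
Proof.
move=> X Y s1 s2.
have /andP[q_gt0 q_lt] := hq.
have qn : (q <= n)%N by apply: leq_trans q_lt (leq_subr _ _).
have q0 : 0 < q%:R :> R by rewrite ltr0n.
have JJt : #|J| = #|Jt| by rewrite hJ.
have cardC (K : {set 'I_n}) : #|K| = q -> #|~: K|%:R = n%:R - q%:R :> R.
  by move=> Kq; rewrite -natrB // -Kq -[n in (n - _)%N]card_ord -(cardsC K) addKn.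
pose W := (basis_mx u)^t* *m basis_mx ut.
pose G := (basis_mx u)^t* *m (Mt - M) *m basis_mx ut.
pose a := opnorm (Mt - M); have a0 : 0 <= a := opnorm_ge0 _.
pose S := blocksq W J (~: Jt).
have S' : blocksq W (~: J) Jt = S.
  exact: blocksq_unitary_sym (overlap_unitary hu hut) JJt.
have dS : dsp X Y ^+ 2 = S / q%:R by rewrite -hJ; apply: dsp_spanE.
have le1 : s1 ^+ 2 * S <= blocksq G J (~: Jt) by apply: sep_blocksq.
have le2 : s2 ^+ 2 * S <= blocksq G (~: J) Jt by rewrite -S'; apply: sep_blocksq.
have s10 : 0 <= s1 := sep_ge0 _ _.
have s20 : 0 <= s2 := sep_ge0 _ _.
split.
  set s := Num.max s1 s2 => s_neq0.
  have s0 : 0 < s by rewrite lt0r s_neq0 le_max s10.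
  (* Whichever separation is the maximum, its block has sides q and n - q in some order; the row and
     column bounds give the two factors. *)
  have key : s ^+ 2 * S <= q%:R * a ^+ 2 /\ s ^+ 2 * S <= (n%:R - q%:R) * a ^+ 2.
    rewrite /s; case: (leP s1 s2) => _; split.
    - apply: le_trans le2 _; rewrite -[in q%:R]hJt.
      exact: blocksq_le_opnorm_col.
    - apply: le_trans le2 _; rewrite -(cardC _ hJ).
      exact: blocksq_le_opnorm_row.
    - apply: le_trans le1 _; rewrite -[in q%:R]hJ.
      exact: blocksq_le_opnorm_row.
    - apply: le_trans le1 _; rewrite -(cardC _ hJt).
      exact: blocksq_le_opnorm_col.
  (* [c] stands for either argument of the minimum, so that q c^2 is q or n - q. *)
  have bound c : 0 <= c -> s ^+ 2 * S <= q%:R * c ^+ 2 * a ^+ 2 ->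
      dsp X Y <= c / s * a.
    move=> c0 le_c; apply: le_of_sqr_le.
      by rewrite !mulr_ge0 // invr_ge0 ltW.
    have -> : (c / s * a) ^+ 2 = q%:R * c ^+ 2 * a ^+ 2 / s ^+ 2 / q%:R.
      by field; rewrite s_neq0 gt_eqF.
    rewrite dS ler_wpM2r ?invr_ge0 ?(ltW q0) // ler_pdivlMr ?exprn_gt0 //.
    by rewrite mulrC.
  have [k1 k2] := key; rewrite /Num.min; case: ifP => _; apply: bound => //.
  - by rewrite expr1n mulr1.
  - exact: sqrtr_ge0.
  - rewrite sqr_sqrtr; last by rewrite divr_ge0 ?(ltW q0) // subr_ge0 ler_nat.
    by rewrite [q%:R * _]mulrC divfK ?gt_eqF.
set t := s1 ^+ 2 + s2 ^+ 2 => _ t_neq0.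
have t0 : 0 < t by rewrite lt0r t_neq0 addr_ge0 ?sqr_ge0.
split; apply: le_of_sqr_le.
- by rewrite !mulr_ge0 ?invr_ge0 ?sqrtr_ge0.
- rewrite dS !exprMn !exprVn frobnorm_sq !sqr_sqrtr ?(ltW q0) ?(ltW t0) //.
  rewrite [leLHS]mulrC -[leRHS]mulrA.
  rewrite ler_wpM2l ?invr_ge0 ?(ltW q0) // ler_pdivlMr // mulrC mulrDl.
  rewrite -(frobsq_perturbation M Mt hu hut) (frobsq_blocks _ J Jt).
  (* What remains is that two of the four disjoint blocks of [G] weigh at most all four. *)
  apply: le_trans (lerD le1 le2) _; rewrite lerD //.
    by rewrite lerDr blocksq_ge0.
  by rewrite lerDl blocksq_ge0.
- by rewrite !mulr_ge0 ?sqrtr_ge0.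
have r0 : 0 <= n%:R / q%:R / t :> R by rewrite !divr_ge0 ?ler0n // ltW.
rewrite !exprMn !exprVn frobnorm_sq !sqr_sqrtr ?(ltW q0) ?(ltW t0) //.
(* With the common factor 1 / (q t) exposed, the squared inequality reduces to
   [frobsq_le_opnorm]. *)
have -> : n%:R / q%:R / t * opnorm (Mt - M) ^+ 2 =
    q%:R^-1 * (n%:R * opnorm (Mt - M) ^+ 2) / t.
  by field; rewrite t_neq0 gt_eqF.
rewrite ler_wpM2r ?invr_ge0 ?(ltW t0) // ler_wpM2l ?invr_ge0 ?(ltW q0) //.
exact: frobsq_le_opnorm hut.
Qed.
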